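(* Let $m\ge 1$ and $1\le p<\infty$. Then $(S^{m,p}, d_p)$ is the completion of $(S^{m}, d_p)$.
   Context: $H$ is the Hausdorff metric on nonempty closed subsets of $\mathbb{R}^m$ (Euclidean distance): $H(A,B)=\max\{\sup_{a\in A}\inf_{b\in B}d(a,b),\ \sup_{b\in B}\inf_{a\in A}d(a,b)\}$ (possibly $+\infty$). A fuzzy set on $\mathbb{R}^m$ is a function $u:\mathbb{R}^m\to[0,1]$; its cuts are $[u]_\alpha=\{x: u(x)\ge\alpha\}$ for $\alpha\in(0,1]$ and $[u]_0=\overline{\{x: u(x)>0\}}$. $S^{m}$ (fuzzy star-shaped numbers) is the set of fuzzy sets $u$ that are normal ($u(x_0)=1$ for some $x_0$), upper semi-continuous, have $[u]_0$ bounded, and are fuzzy star-shaped: there exists $x\in\mathbb{R}^m$ such that $u(\lambda y+(1-\lambda)x)\ge u(y)$ for all $y\in\mathbb{R}^m$ and $\lambda\in[0,1]$. $S^{m,p}$ is defined in the same way, with the condition ''$[u]_0$ bounded'' replaced by $\left(\int_0^1 H([u]_\alpha,\{0\})^p\,d\alpha\right)^{1/p}<+\infty$, where $0$ is the origin; so $S^m\subset S^{m,p}$. The metric on both is $d_p(u,v)=\left(\int_0^1 H([u]_\alpha,[v]_\alpha)^p\,d\alpha\right)^{1/p}$. A metric space $Y$ is the completion of a subspace $X\subset Y$ if $Y$ is complete and $X$ is dense in $Y$. *)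

(* Defs.v *)
From HB Require Import structures.
From mathcomp Require Import all_boot all_order all_algebra.
From mathcomp Require Import all_classical all_reals all_analysis.
Set Implicit Arguments.
Unset Strict Implicit.
Unset Printing Implicit Defensive.
Import Order.TTheory GRing.Theory Num.Theory.
Import numFieldNormedType.Exports.
Local Open Scope classical_set_scope.
Local Open Scope ring_scope.

(* R^m is 'rV[R]_m. The library norm on matrices is the max norm, hence the
   explicit Euclidean distance; the library's topology (closure, near) and
   bounded_set on 'rV[R]_m agree with the Euclidean ones. *)
Definition edist (R : realType) (m : nat) (x y : 'rV[R]_m) : R :=
  Num.sqrt (\sum_(i < m) (x 0 i - y 0 i) ^+ 2).

Definition hausdorff (R : realType) (m : nat) (A B : set 'rV[R]_m) : \bar R :=
  maxe
    (ereal_sup [set ereal_inf [set (edist a b)%:E | b in B] | a in A])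
    (ereal_sup [set ereal_inf [set (edist a b)%:E | a in A] | b in B]).

Definition fuzzy_set (R : realType) (m : nat) (u : 'rV[R]_m -> R) : Prop :=
  forall x, 0 <= u x <= 1.

(* Only meant for 0 <= a <= 1. *)
Definition cut (R : realType) (m : nat) (u : 'rV[R]_m -> R) (a : R) :
    set 'rV[R]_m :=
  if a == 0 then closure [set x | 0 < u x] else [set x | a <= u x].

Definition normal_fuzzy (R : realType) (m : nat) (u : 'rV[R]_m -> R) : Prop :=
  exists x0, u x0 = 1.

(* The library only has lower_semicontinuous, for \bar R-valued functions. *)
Definition upper_semicontinuous (R : realType) (m : nat)
    (u : 'rV[R]_m -> R) : Prop :=
  forall x a, u x < a -> \forall y \near x, u y < a.

Definition fuzzy_star_shaped (R : realType) (m : nat)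
    (u : 'rV[R]_m -> R) : Prop :=
  exists x, forall (y : 'rV[R]_m) (l : R), 0 <= l <= 1 ->
    u y <= u (l *: y + (1 - l) *: x).

Definition fuzzy_Sm (R : realType) (m : nat) : set ('rV[R]_m -> R) :=
  [set u | [/\ fuzzy_set u, normal_fuzzy u, upper_semicontinuous u,
               bounded_set (cut u 0) & fuzzy_star_shaped u]].

Definition fuzzy_Smp (R : realType) (m : nat) (p : R) :
    set ('rV[R]_m -> R) :=
  [set u | [/\ fuzzy_set u, normal_fuzzy u, upper_semicontinuous u,
               ((\int[lebesgue_measure]_(a in `[0%R, 1%R])
                   (hausdorff (cut u a) [set 0%R]) `^ p) `^ p^-1 < +oo)%E
             & fuzzy_star_shaped u]].

Definition dp (R : realType) (m : nat) (p : R) (u v : 'rV[R]_m -> R) : \bar R :=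
  ((\int[lebesgue_measure]_(a in `[0%R, 1%R])
      (hausdorff (cut u a) (cut v a)) `^ p) `^ p^-1)%E.

(* A distance on Y is given as an \bar R-valued function on an ambient type,
   whose finiteness on Y is part of being a metric. *)
Definition metric_on (R : realType) (T : Type) (Y : set T)
    (d : T -> T -> \bar R) : Prop :=
  [/\ (forall x y, Y x -> Y y -> (0 <= d x y < +oo)%E),
      (forall x y, Y x -> Y y -> (d x y = 0%E <-> x = y)),
      (forall x y, Y x -> Y y -> d x y = d y x) &
      (forall x y z, Y x -> Y y -> Y z -> (d x z <= d x y + d y z)%E)].

Definition complete_on (R : realType) (T : Type) (Y : set T)
    (d : T -> T -> \bar R) : Prop :=
  forall s : nat -> T, (forall n, Y (s n)) ->
    (forall e : R, 0 < e -> exists N : nat, forall i j : nat,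
       (N <= i)%N -> (N <= j)%N -> (d (s i) (s j) < e%:E)%E) ->
    exists2 x, Y x & d (s n) x @[n --> \oo] --> 0%E.

Definition dense_in (R : realType) (T : Type) (X Y : set T)
    (d : T -> T -> \bar R) : Prop :=
  forall y, Y y -> forall e : R, 0 < e -> exists2 x, X x & (d x y < e%:E)%E.

Definition is_completion_of (R : realType) (T : Type) (Y X : set T)
    (d : T -> T -> \bar R) : Prop :=
  [/\ metric_on Y d, X `<=` Y, complete_on Y d & dense_in X Y d].

(* Main.v *)
Require Import Defs.
From mathcomp Require Import all_boot all_order all_algebra.
From mathcomp Require Import all_classical all_reals all_analysis.
From mathcomp Require Import measurable_realfun.
From mathcomp Require Import ring lra.
Set Implicit Arguments.
Unset Strict Implicit.
Unset Printing Implicit Defensive.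
Import Order.TTheory GRing.Theory Num.Theory.
Import numFieldNormedType.Exports.
Local Open Scope classical_set_scope.
Local Open Scope ring_scope.

(** The Hausdorff distance of nonempty sets is the sup distance of their
    distance functions x |-> d(x, A), and rational x suffice. As d(x, [u]_a)
    is monotone in a, the integrand of d_p is measurable, and the metric axioms
    come from Minkowski's inequality. Truncating u at a small level t (which
    replaces [u]_a by [u]_(max t a)) gives density, by dominated convergence.

    For completeness, take a subsequence v_k whose consecutive distances are
    summable. By the countable Minkowski inequality, for almost every a the
    series of H([v_k]_a, [v_(k+1)]_a) converges. Let L_b be the lower limit of
    the [v_k]_b and u(x) = sup {b | x in L_b}. A cluster point of star centers
    of the v_k is a star center of u at which u = 1. Finally g(a) = lim d(x,
    [v_k]_a) is monotone in a and g(a-) <= d(x, [u]_a) <= g(a), so that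
    [v_k]_a tends to [u]_a for all but countably many of these a, and the tails
    of the series bound d_p(v_k, u). *)

(* Both names are also used by the libraries. *)
Local Notation edist := Defs.edist.
Local Notation cut := Defs.cut.

(** * Euclidean distance *)

Section Euclidean.
Context {R : realType} {m : nat}.
Implicit Types (x y z v w : 'rV[R]_m) (A B : set 'rV[R]_m).

Definition enorm v : R := Num.sqrt (\sum_(i < m) v 0 i ^+ 2).

Lemma edistE x y : edist x y = enorm (x - y).
Proof. by congr Num.sqrt; apply: eq_bigr => i _; rewrite !mxE. Qed.

Lemma sqr_enorm v : enorm v ^+ 2 = \sum_(i < m) v 0 i ^+ 2.
Proof. by rewrite sqr_sqrtr// sumr_ge0// => i _; rewrite sqr_ge0. Qed.

Lemma enorm_ge0 v : 0 <= enorm v.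
Proof. exact: sqrtr_ge0. Qed.

Lemma enormZ (l : R) v : enorm (l *: v) = `|l| * enorm v.
Proof.
rewrite /enorm -sqrtr_sqr -sqrtrM ?sqr_ge0// mulr_sumr.
by congr Num.sqrt; apply: eq_bigr => i _; rewrite mxE exprMn.
Qed.

Lemma enormN v : enorm (- v) = enorm v.
Proof. by rewrite -scaleN1r enormZ normrN normr1 mul1r. Qed.

(** The nonnegative sum of the squares of [enorm w * v_i - enorm v * w_i] is expanded and divided by
    [2 * enorm v * enorm w]; a zero norm forces all coordinates to vanish. *)
Lemma cauchy_schwarz v w : \sum_(i < m) v 0 i * w 0 i <= enorm v * enorm w.
Proof.
have := enorm_ge0 v; rewrite le_eqVlt => /predU1P[v0|v0].
  have /eqP := sqr_enorm v; rewrite -v0 expr0n/= eq_sym psumr_eq0; last first.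
    by move=> i _; rewrite sqr_ge0.
  move=> /allP v00; rewrite mul0r big1// => i _.
  have := v00 i (mem_index_enum _); rewrite /= sqrf_eq0 => /eqP ->.
  by rewrite mul0r.
have := enorm_ge0 w; rewrite le_eqVlt => /predU1P[w0|w0].
  have /eqP := sqr_enorm w; rewrite -w0 expr0n/= eq_sym psumr_eq0; last first.
    by move=> i _; rewrite sqr_ge0.
  move=> /allP w00; rewrite mulr0 big1// => i _.
  have := w00 i (mem_index_enum _); rewrite /= sqrf_eq0 => /eqP ->.
  by rewrite mulr0.
have h : 0 <= \sum_(i < m) (enorm w * v 0 i - enorm v * w 0 i) ^+ 2.
  by rewrite sumr_ge0// => i _; rewrite sqr_ge0.
have E i : (enorm w * v 0 i - enorm v * w 0 i) ^+ 2 =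
    enorm w ^+ 2 * v 0 i ^+ 2 +
    (- (2 * enorm w * enorm v) * (v 0 i * w 0 i) + enorm v ^+ 2 * w 0 i ^+ 2).
  by ring.
move: h; under eq_bigr do rewrite E.
rewrite !big_split/= -!mulr_sumr -!sqr_enorm; set s := \sum_(i < m) _ => h.
rewrite -(ler_pM2l (mulr_gt0 w0 v0)) -(ler_pM2l (ltr0n _ 2)).
lra.
Qed.

Lemma enormD v w : enorm (v + w) <= enorm v + enorm w.
Proof.
rewrite -(ler_pXn2r (n := 2))// ?nnegrE ?addr_ge0 ?enorm_ge0//.
rewrite sqr_enorm sqrrD !sqr_enorm.
under eq_bigr do rewrite mxE sqrrD.
rewrite big_split big_split lerD2r lerD2l.
by rewrite sumrMnl lerMn2r/= cauchy_schwarz.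
Qed.

Lemma edist_ge0 x y : 0 <= edist x y.
Proof. exact: sqrtr_ge0. Qed.

Lemma edistxx x : edist x x = 0.
Proof. by rewrite edistE subrr -(scale0r 0) enormZ normr0 mul0r. Qed.

Lemma edist_sym x y : edist x y = edist y x.
Proof. by rewrite !edistE -enormN opprB. Qed.

Lemma edist_triangle y x z : edist x z <= edist x y + edist y z.
Proof.
by rewrite !edistE; apply: le_trans (enormD _ _); rewrite addrA subrK.
Qed.

Lemma edist_convex (l : R) x y x' y' : 0 <= l <= 1 ->
  edist (l *: y + (1 - l) *: x) (l *: y' + (1 - l) *: x')
  <= edist y y' + edist x x'.
Proof.
move=> /andP[l0 l1]; rewrite !edistE opprD addrACA -!scalerBr.
apply: (le_trans (enormD _ _)); rewrite !enormZ !ger0_norm ?subr_ge0//.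
have := enorm_ge0 (y - y'); have := enorm_ge0 (x - x').
by move=> hx hy; apply: lerD; rewrite ler_piMl//; lra.
Qed.

Lemma norm_le_edist x y : `|x - y| <= edist x y.
Proof.
rewrite edistE {1}/Num.norm/= mx_normrE.
apply: bigmax_le => [|[i j] _]; first exact: enorm_ge0.
rewrite /= ord1 /enorm -sqrtr_sqr ler_sqrt; last first.
  by rewrite sumr_ge0// => k _; rewrite sqr_ge0.
by rewrite (bigD1 j)//= lerDl sumr_ge0// => k _; rewrite sqr_ge0.
Qed.

Lemma edist_le_coord (e : R) x y : 0 <= e ->
  (forall i, `|x 0 i - y 0 i| <= e) -> edist x y <= m%:R * e.
Proof.
move=> e0 xye; rewrite /edist -[leRHS]ger0_norm ?mulr_ge0// -sqrtr_sqr.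
rewrite ler_sqrt ?sqr_ge0// (@le_trans _ _ (\sum_(i < m) e ^+ 2))//.
  apply: ler_sum => i _; rewrite -real_normK ?num_real//.
  by rewrite ler_pXn2r ?nnegrE.
rewrite sumr_const card_ord exprMn -[leLHS]mulr_natl.
have h := sqr_ge0 e; rewrite ler_wpM2r//.
by rewrite -natrX ler_nat; case: m => // n; rewrite leq_pmull.
Qed.

Lemma edist_le_norm x y : edist x y <= m%:R * `|x - y|.
Proof.
apply: edist_le_coord => // i.
rewrite [leRHS]/Num.norm/= mx_normrE; apply/bigmax_geP; right.
by exists (0, i) => //=; rewrite !mxE.
Qed.

Lemma rat_row_dense x (e : R) : 0 < e ->
  exists q : 'rV[rat]_m, edist x (map_mx ratr q) < e.
Proof.
(* The successor keeps the divisor positive and makes [m * d < e] strict. *)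
move=> e0; pose d := e / m.+1%:R.
have d0 : 0 < d by rewrite divr_gt0.
have h i : exists q : rat, `|x 0 i - ratr q| <= d.
  have : x 0 i - d < x 0 i + d by lra.
  move=> /rat_in_itvoo[q]; rewrite in_itv/= => /andP[q1 q2].
  by exists q; rewrite ler_norml; lra.
have [f fP] := choice h.
exists (\row_i f i); apply: (@le_lt_trans _ _ (m%:R * d)).
  by apply: edist_le_coord; [exact: ltW|move=> i; rewrite !mxE].
rewrite /d mulrCA gtr_pMr// ltr_pdivrMr// mul1r ltr_nat.
by [].
Qed.

(** The max norm and the Euclidean norm bound each other up to a factor [m], so neighbourhoods can
    be tested on Euclidean balls. *)
Lemma near_edist x (P : 'rV[R]_m -> Prop) :
  (\forall y \near x, P y) <->
  exists2 e : R, 0 < e & forall y, edist x y < e -> P y.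
Proof.
split=> [/nbhs_normP[e /= e0 eP]|[e e0 eP]].
  exists e => // y xye; apply: eP => /=.
  exact: le_lt_trans (norm_le_edist _ _) xye.
apply/nbhs_normP; exists (e / m.+1%:R) => /=; first by rewrite divr_gt0.
move=> y /= xy; apply: eP; apply: le_lt_trans (edist_le_norm _ _) _.
have : m.+1%:R * `|x - y| < e by rewrite mulrC -ltr_pdivlMr.
apply: le_lt_trans; rewrite ler_wpM2r// ler_nat//.
Qed.

Lemma bounded_seq_cluster (c : nat -> 'rV[R]_m) (M : R) N0 :
  (forall k, (N0 <= k)%N -> edist (c k) 0 <= M) ->
  exists x, forall (e : R) N, 0 < e ->
    exists2 k, (N <= k)%N & edist x (c k) < e.
Proof.
move=> cM.
(* The radius [M + 1] is positive as soon as some term is bounded by [M], as the explicit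
   description of the closed ball requires. *)
have : compact (closed_ball (0 : 'rV[R]_m) (M + 1)).
  apply: bounded_closed_compact; last exact: closed_ball_closed.
  have [M0|M0] := ltP 0 (M + 1); last first.
    rewrite closed_ball0//.
    by exists 0; split => // ? ? ? [].
  exists (M + 1); split; first exact: num_real.
  move=> y My z; rewrite closed_ballE// /closed_ball_/= sub0r normrN => h.
  exact: le_trans h (ltW My).
move=> /(_ (c @ \oo) _) [].
  exists N0 => // k /= N0k.
  have ckM := cM _ N0k.
  have := edist_ge0 (c k) 0 => ck0.
  rewrite closed_ballE; last lra.
  rewrite /closed_ball_/= distrC; apply: (le_trans (norm_le_edist _ _)); lra.
move=> x [_ xc]; exists x => e N e0.
have [] := xc [set y | exists2 k, (N <= k)%N & y = c k] [set y | edist x y < e].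
- by exists N => // k /= Nk; exists k.
- by apply/near_edist; exists e.
- by move=> _ [[k Nk ->] xk]; exists k.
Qed.

End Euclidean.

(** * Hausdorff distance *)

Section Hausdorff.
Context {R : realType} {m : nat}.
Implicit Types (x y z : 'rV[R]_m) (A B C : set 'rV[R]_m).

(** The infimum of the empty set defaults to 0, hence the nonemptiness hypotheses below. *)
Definition dist A x : R := inf [set edist x a | a in A].

Let dist_lbound A x : has_lbound [set edist x a | a in A].
Proof. by exists 0 => _ [a _ <-]; exact: edist_ge0. Qed.

Lemma dist_le A a x : A a -> dist A x <= edist x a.
Proof. by move=> Aa; apply: ge_inf; [exact: dist_lbound|exists a]. Qed.

Lemma dist_ge A x (r : R) : A !=set0 ->
  (forall a, A a -> r <= edist x a) -> r <= dist A x.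
Proof.
move=> [a Aa] Ar; apply: lb_le_inf; first by exists (edist x a); exists a.
by move=> _ [b Ab <-]; exact: Ar.
Qed.

Lemma dist_lt A x (r : R) : A !=set0 -> dist A x < r ->
  exists2 a, A a & edist x a < r.
Proof.
move=> A0 Axr; apply: contrapT => h; move: Axr; rewrite ltNge => /negP; apply.
apply: dist_ge => // a Aa; rewrite leNgt; apply/negP => xa.
by apply: h; exists a.
Qed.

Lemma dist_ge0 A x : A !=set0 -> 0 <= dist A x.
Proof. by move=> A0; apply: dist_ge => // a _; exact: edist_ge0. Qed.

Lemma dist_mem A x : A x -> dist A x = 0.
Proof.
move=> Ax; apply/eqP; rewrite eq_le dist_ge0 ?andbT; last by exists x.
by rewrite (le_trans (dist_le _ Ax))// edistxx.
Qed.

Lemma dist_lipschitz A x y : A !=set0 -> dist A x <= edist x y + dist A y.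
Proof.
move=> A0; rewrite -lerBlDl; apply: dist_ge => // a Aa.
by rewrite lerBlDl (le_trans (dist_le _ Aa))// edist_triangle.
Qed.

Lemma dist_subset A B x : A !=set0 -> A `<=` B -> dist B x <= dist A x.
Proof. by move=> A0 AB; apply: dist_ge => // a /AB; exact: dist_le. Qed.

Lemma dist_set1 x y : dist [set y] x = edist x y.
Proof.
apply/eqP; rewrite eq_le dist_le//=; apply: dist_ge; first by exists y.
by move=> _ ->.
Qed.

Lemma ereal_inf_dist A x : A !=set0 ->
  ereal_inf [set (edist x a)%:E | a in A] = (dist A x)%:E.
Proof.
move=> A0; rewrite -ereal_inf_EFin//; first by rewrite image_comp.
by case: A0 => a Aa; exists (edist x a), a.
Qed.

Lemma hausdorffE A B : A !=set0 -> B !=set0 ->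
  hausdorff A B = maxe (ereal_sup [set (dist B a)%:E | a in A])
                       (ereal_sup [set (dist A b)%:E | b in B]).
Proof.
move=> A0 B0; congr (maxe (ereal_sup _) (ereal_sup _)).
  by apply: eq_imagel => a Aa; rewrite ereal_inf_dist.
apply: eq_imagel => b Bb; rewrite -ereal_inf_dist//.
by congr ereal_inf; apply: eq_imagel => a Aa; rewrite edist_sym.
Qed.

(* Comparing distance functions at rational points only makes the Hausdorff
   distance a countable supremum. *)
Lemma hausdorff_le A B (M : \bar R) : A !=set0 -> B !=set0 ->
  (forall q : 'rV[rat]_m,
    (`|dist A (map_mx ratr q) - dist B (map_mx ratr q)|%:E <= M)%E) ->
  (hausdorff A B <= M)%E.
Proof.
move=> A0 B0; case: M => [r| |] h; last 2 first.
- by rewrite leey.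
- by have := h 0; rewrite leeNy_eq.
have {}h x : `|dist A x - dist B x| <= r.
  apply/ler_addgt0Pr => e e0; have e4 : 0 < e / 2 by rewrite divr_gt0.
  have [q xq] := rat_row_dense x e4; have := h q; rewrite lee_fin.
  set y := map_mx _ _ in xq *.
  have := dist_lipschitz x y A0; have := dist_lipschitz x y B0.
  have := dist_lipschitz y x A0; have := dist_lipschitz y x B0.
  rewrite (edist_sym y x) !ler_norml => ? ? ? ? /andP[? ?].
  by apply/andP; split; lra.
rewrite hausdorffE// ge_max; apply/andP; split; apply: ge_ereal_sup.
  move=> _ [a Aa <-]; rewrite lee_fin; have := h a.
  by rewrite dist_mem// sub0r normrN ger0_norm// dist_ge0.
move=> _ [a Aa <-]; rewrite lee_fin; have := h a.
by rewrite [X in _ - X]dist_mem// subr0 ger0_norm// dist_ge0.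
Qed.

(** If [dist D a <= r] for every [a] in [C], then [dist D x <= edist x a + r], and the infimum over
    [a] bounds [dist D x - dist C x] by [r]. *)
Lemma hausdorff_ge A B x : A !=set0 -> B !=set0 ->
  (`|dist A x - dist B x|%:E <= hausdorff A B)%E.
Proof.
move=> A0 B0; rewrite hausdorffE//.
have half (C D : set 'rV[R]_m) : C !=set0 -> D !=set0 ->
    ((dist D x - dist C x)%:E <= ereal_sup [set (dist D a)%:E | a in C])%E.
  move=> C0 D0; have := @ereal_sup_ubound _ [set (dist D a)%:E | a in C].
  case: (ereal_sup _) => [r| |] ub; last 2 first.
  - by rewrite leey.
  - case: C0 => c Cc; have : (dist D c)%:E = -oo%E by
      apply/eqP; rewrite -leeNy_eq; apply: ub; exists c.
    by [].
  rewrite lee_fin lerBlDl addrC -lerBlDl; apply: dist_ge => // a Ca.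
  have : dist D a <= r by rewrite -lee_fin; apply: ub; exists a.
  have := dist_lipschitz x a D0; lra.
rewrite /maxe le_max; have [AB|/ltW AB] := leP (dist A x) (dist B x).
  by rewrite ler0_norm ?subr_le0// opprB half.
by rewrite ger0_norm ?subr_ge0// (half B A)// orbT.
Qed.

Lemma hausdorff_sup_rat A B : A !=set0 -> B !=set0 ->
  hausdorff A B = ereal_sup
    [set (`|dist A (map_mx ratr q) - dist B (map_mx ratr q)|%:E)%E
    | q in [set: 'rV[rat]_m]].
Proof.
move=> A0 B0; apply/eqP; rewrite eq_le; apply/andP; split.
  by apply: hausdorff_le => // q; apply: ereal_sup_ubound; exists q.
by apply: ge_ereal_sup => _ [q _ <-]; exact: hausdorff_ge.
Qed.

Lemma hausdorff_ge0 A B : A !=set0 -> B !=set0 -> (0 <= hausdorff A B)%E.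
Proof.
by move=> A0 B0; apply: le_trans (hausdorff_ge 0 A0 B0); rewrite lee_fin.
Qed.

Lemma hausdorff_sym A B : hausdorff A B = hausdorff B A.
Proof.
rewrite /hausdorff [LHS]maxC; congr (maxe (ereal_sup _) (ereal_sup _)).
all: apply: eq_imagel => a _; congr ereal_inf; apply: eq_imagel => b _.
all: by rewrite edist_sym.
Qed.

Lemma hausdorffxx A : A !=set0 -> hausdorff A A = 0%E.
Proof.
move=> A0; apply/eqP; rewrite eq_le hausdorff_ge0// andbT.
by apply: hausdorff_le => // q; rewrite subrr normr0.
Qed.

Lemma hausdorff_triangle B A C : A !=set0 -> B !=set0 -> C !=set0 ->
  (hausdorff A C <= hausdorff A B + hausdorff B C)%E.
Proof.
move=> A0 B0 C0; apply: hausdorff_le => // q; set x := map_mx _ _.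
apply: le_trans (leeD (hausdorff_ge x A0 B0) (hausdorff_ge x B0 C0)).
by rewrite -EFinD lee_fin (le_trans _ (ler_normD _ _))// addrA subrK.
Qed.

Lemma hausdorff0_le A (r : R) : A !=set0 -> (forall a, A a -> edist a 0 <= r) ->
  (hausdorff A [set 0%R] <= r%:E)%E.
Proof.
move=> [a0 Aa0] Ar; have A0 : A !=set0 by exists a0.
apply: hausdorff_le => //; first by exists 0.
move=> q; set x := map_mx _ _; rewrite lee_fin dist_set1 ler_norml.
apply/andP; split.
  have : edist x 0 - r <= dist A x.
    apply: dist_ge => // a /Ar; have := edist_triangle a x 0; lra.
  lra.
have := dist_le x Aa0; have := edist_triangle 0 x a0; have := Ar _ Aa0.
rewrite (edist_sym 0); lra.
Qed.

Lemma hausdorff0_ge A a : A a -> ((edist a 0)%:E <= hausdorff A [set 0%R])%E.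
Proof.
move=> Aa; apply: le_trans (hausdorff_ge a _ _); [|by exists a|by exists 0].
by rewrite lee_fin dist_mem// dist_set1 sub0r normrN ler_norm.
Qed.

Lemma hausdorff0_subset A B : A !=set0 -> A `<=` B ->
  (hausdorff A [set 0%R] <= hausdorff B [set 0%R])%E.
Proof.
move=> A0 AB; have [a /AB Ba] := A0.
have : (0 <= hausdorff B [set 0%R])%E.
  by apply: hausdorff_ge0; [exists a|exists 0].
case E : (hausdorff B [set 0%R]) => [r| |]; [|by rewrite !leey|by []].
move=> _; apply: hausdorff0_le => // b /AB /hausdorff0_ge.
by rewrite E lee_fin.
Qed.

End Hausdorff.

(** * Cuts, and measurability in the level *)

Section Cuts.
Context {R : realType} {m : nat}.
Implicit Types u v w : 'rV[R]_m -> R.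

Lemma cutE u (a : R) : 0 < a -> cut u a = [set x | a <= u x].
Proof. by move=> a0; rewrite /cut gt_eqF. Qed.

Lemma cut_subset u (a b : R) : 0 <= a -> a <= b -> cut u b `<=` cut u a.
Proof.
rewrite le_eqVlt => /predU1P[<-|a0] ab x; last first.
  by rewrite !cutE// ?(lt_le_trans a0)//=; exact: le_trans.
move: ab; rewrite le_eqVlt => /predU1P[->//|b0].
rewrite cutE//= /cut eqxx => bu; apply: subset_closure => /=.
exact: lt_le_trans bu.
Qed.

Lemma cut_neq0 u (a : R) : normal_fuzzy u -> 0 <= a <= 1 -> cut u a !=set0.
Proof.
move=> [x ux1] /andP[a0 a1]; exists x; apply: (cut_subset a0 a1).
by rewrite cutE//= ux1.
Qed.

(** Upper semicontinuity makes the cut closed: if [u x < a], a whole ball around [x] misses it. *)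
Lemma dist_cut_mem u (a : R) x : upper_semicontinuous u -> normal_fuzzy u ->
  0 < a <= 1 -> dist (cut u a) x = 0 -> a <= u x.
Proof.
move=> usc nu /andP[a0 a1] d0; rewrite leNgt; apply/negP => /usc/near_edist.
move=> [e e0 eu].
have [||y] := @dist_lt _ _ (cut u a) x e; last 1 first.
- by rewrite cutE//= => ay /eu; rewrite ltNge ay.
- by apply: cut_neq0; rewrite // (ltW a0).
- by rewrite d0.
Qed.

Lemma measurable_dist_cut u x : normal_fuzzy u ->
  measurable_fun (`[0%R, 1%R] : set R) (fun a => dist (cut u a) x).
Proof.
(* Clamping the level to the unit interval gives a function that is monotone on the whole line,
   since cuts shrink as the level grows. *)
move=> nu; pose f (a : R) := dist (cut u (Num.max 0 (Num.min a 1))) x.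
apply: (@eq_measurable_fun _ _ _ _ _ f).
  move=> a; rewrite inE/= in_itv/= => /andP[a0 a1].
  by rewrite /f min_l// max_r.
apply: nondecreasing_measurable => // a b ab; rewrite /f.
apply: dist_subset.
  apply: cut_neq0 => //; rewrite le_max lexx/= ge_max ler01/=.
  by rewrite ge_min lexx orbT.
apply: cut_subset; first by rewrite le_max lexx.
by rewrite ge_max !le_max lexx/= le_min !ge_min ab lexx !orbT.
Qed.

Lemma measurable_hausdorff_cut u v : normal_fuzzy u -> normal_fuzzy v ->
  measurable_fun (`[0%R, 1%R] : set R) (fun a => hausdorff (cut u a) (cut v a)).
Proof.
move=> nu nv.
(* The supremum over rational points becomes one over their codes; integers that code no point
   contribute 0, harmless as the distance is nonnegative. *)
pose h (n : nat) (a : R) : \bar R :=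
  if unpickle n is Some q then
    (`|dist (cut u a) (map_mx ratr (q : 'rV[rat]_m))
       - dist (cut v a) (map_mx ratr q)|%:E)%E
  else 0%E.
apply: (@eq_measurable_fun _ _ _ _ _ (fun a => esups (h ^~ a) 0%N)).
  move=> a; rewrite inE/= in_itv/= => a01.
  have u0 := cut_neq0 nu a01; have v0 := cut_neq0 nv a01.
  rewrite hausdorff_sup_rat//; apply/eqP; rewrite eq_le; apply/andP; split.
    apply: ge_ereal_sup => _ [n _ <-]; rewrite /h; case: unpickle => [q|].
      by apply: ereal_sup_ubound; exists q.
    by rewrite -hausdorff_sup_rat// hausdorff_ge0.
  apply: ge_ereal_sup => _ [q _ <-]; apply: ereal_sup_ubound.
  by exists (pickle q) => //; rewrite /h pickleK.
apply: measurable_fun_esups => n; rewrite /h; case: unpickle => [q|].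
  apply/measurable_EFinP; apply: measurableT_comp => //.
  by apply: measurable_funB; exact: measurable_dist_cut.
exact: measurable_cst.
Qed.

(* The crisp fuzzy point at the origin: all its cuts are {0}, so that the norm
   condition defining [fuzzy_Smp] is a distance to it. *)
Definition fuzzy_origin : 'rV[R]_m -> R := fun x => (x == 0)%:R.

Lemma normal_fuzzy_origin : normal_fuzzy fuzzy_origin.
Proof. by exists 0; rewrite /fuzzy_origin eqxx. Qed.

Lemma cut_fuzzy_origin (a : R) : 0 <= a <= 1 -> cut fuzzy_origin a = [set 0].
Proof.
move=> /andP[a0 a1]; rewrite /cut; case: eqVneq => [_|an0].
  rewrite [X in closure X](_ : _ = [set 0]); last first.
    apply/seteqP; split => x; rewrite /fuzzy_origin /=.
      by case: eqVneq => //= _; rewrite ltxx.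
    by move=> ->; rewrite eqxx.
  apply/esym/closure_id; apply: accessible_closed_set1.
  apply: hausdorff_accessible; exact: norm_hausdorff.
apply/seteqP; split => x; rewrite /fuzzy_origin /=; last first.
  by move=> ->; rewrite eqxx.
case: eqVneq => //= _ a0'; have : a = 0 by apply/eqP; rewrite eq_le a0 a0'.
by move/eqP: an0.
Qed.

End Cuts.

(** * Integral norms of nonnegative extended real functions *)

Lemma ge0_lte_dense (R : realType) (x y : \bar R) : (0 <= x)%E -> (x < y)%E ->
  exists z, (x < z < y)%E.
Proof.
case: x => [x| |]//; last by move=> _; rewrite ltNge leey.
case: y => [y| |]// _; rewrite ?lte_fin => xy; last first.
  by exists (x + 1)%:E; rewrite ltry lte_fin ltrDl ltr01.
by exists ((x + y) / 2)%:E; rewrite !lte_fin !midf_lt.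
Qed.

Section Lp.
Local Open Scope ereal_scope.
Context d (T : measurableType d) (R : realType).
Variables (mu : {measure set T -> \bar R}) (D : set T) (p : R).
Hypotheses (mD : measurable D) (p1 : (1 <= p)%R).
Implicit Types f g : T -> \bar R.

Let p0 : (0 < p)%R. Proof. exact: lt_le_trans p1. Qed.
Let pV0 : (p^-1 != 0)%R. Proof. by rewrite invr_eq0 gt_eqF. Qed.

Definition Lp f : \bar R := (\int[mu]_(x in D) (f x `^ p)) `^ p^-1.

Let pint_ge0 f : 0 <= \int[mu]_(x in D) (f x `^ p).
Proof. by apply: integral_ge0 => x _; exact: poweR_ge0. Qed.

Lemma Lp_ge0 f : 0 <= Lp f.
Proof. exact: poweR_ge0. Qed.

Lemma eq_Lp f g : {in D, f =1 g} -> Lp f = Lp g.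
Proof.
by move=> fg; rewrite /Lp; congr (_ `^ _); apply: eq_integral => x /fg ->.
Qed.

Lemma poweR_Lp f : Lp f `^ p = \int[mu]_(x in D) (f x `^ p).
Proof. by rewrite /Lp -poweRrM mulVf ?gt_eqF// poweRe1. Qed.

Let measurable_pow f : measurable_fun D f ->
  measurable_fun D (fun x => f x `^ p).
Proof. by move=> mf; exact: (measurableT_comp (measurable_poweR p) mf). Qed.

Lemma le_poweR (x y : \bar R) (r : R) : (0 <= r)%R -> 0 <= x -> x <= y ->
  x `^ r <= y `^ r.
Proof.
move=> r0 x0 xy; apply: gt0_ler_poweR => //; rewrite in_itv/= leey andbT//.
exact: le_trans xy.
Qed.

Lemma le_Lp f g : measurable_fun D f -> measurable_fun D g ->
  (forall x, D x -> 0 <= f x) -> (forall x, D x -> 0 <= g x) ->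
  {ae mu, forall x, D x -> f x <= g x} -> Lp f <= Lp g.
Proof.
move=> mf mg f0 g0 fg; apply: le_poweR => //; first by rewrite invr_ge0 ltW.
apply: ae_ge0_le_integral => //.
- by move=> x _; exact: poweR_ge0.
- exact: measurable_pow.
- by move=> x _; exact: poweR_ge0.
- exact: measurable_pow.
by apply: filterS fg => x fgx Dx; apply: le_poweR; rewrite ?(ltW p0) ?f0 ?fgx.
Qed.

Lemma Lp_fin_num f : measurable_fun D f -> (forall x, D x -> 0 <= f x) ->
  Lp f < +oo -> {ae mu, forall x, D x -> f x \is a fin_num}.
Proof.
move=> mf f0 /(lty_poweRy pV0) foo.
have /(integrable_ae mD) : mu.-integrable D (fun x => f x `^ p).
  apply/integrableP; split; first exact: measurable_pow.
  by under eq_integral do rewrite gee0_abs ?poweR_ge0//.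
apply: filterS => x fx Dx; rewrite ge0_fin_numE ?f0//.
by apply: (@lty_poweRy _ _ p); rewrite ?gt_eqF// ltey_eq fx.
Qed.

(** Replacing an almost everywhere finite [f] by its finite part, extended by 0 outside [D], gives
    access to Minkowski's inequality for real functions. *)
Let Lp_Lnorm f : measurable_fun D f -> (forall x, D x -> 0 <= f x) ->
  {ae mu, forall x, D x -> f x \is a fin_num} ->
  Lp f = 'N[mu]_p%:E[EFin \o ((fine \o f) \_ D)].
Proof.
move=> mf f0 ffin; rewrite unlock /Lp; congr (_ `^ _).
rewrite [RHS](_ : _ = \int[mu]_(x in D) ((fine (f x))%:E `^ p)); last first.
  rewrite [RHS]integral_mkcond; apply: eq_integral => x _.
  rewrite patchE /= patchE; case: ifPn => [/set_mem Dx|_]; last first.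
    by rewrite /= normr0 powR0 ?gt_eqF.
  by rewrite /= ger0_norm// fine_ge0 ?f0.
apply: ae_eq_integral => //.
- exact: measurable_pow.
- apply: measurable_pow; apply/measurable_EFinP.
  exact: measurableT_comp.
by apply: filterS ffin => x ffx Dx; rewrite fineK// ffx.
Qed.

Lemma Lp_le_add f g h : measurable_fun D f -> measurable_fun D g ->
  measurable_fun D h ->
  (forall x, D x -> 0 <= f x) -> (forall x, D x -> 0 <= g x) ->
  (forall x, D x -> 0 <= h x) ->
  {ae mu, forall x, D x -> h x <= f x + g x} -> Lp h <= Lp f + Lp g.
Proof.
move=> mf mg mh f0 g0 h0 hfg.
have fg0 x : D x -> 0 <= f x + g x by move=> Dx; rewrite adde_ge0 ?f0 ?g0.
have mfg : measurable_fun D (f \+ g) by exact: emeasurable_funD.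
apply: (@le_trans _ _ (Lp (f \+ g))); first exact: le_Lp.
(* An infinite norm makes the bound trivial; otherwise both functions are finite almost
   everywhere. *)
have [->|foo] := eqVneq (Lp f) +oo.
  by rewrite addye ?leey// -ltNye (lt_le_trans _ (Lp_ge0 _)).
have [->|goo] := eqVneq (Lp g) +oo.
  by rewrite addey ?leey// -ltNye (lt_le_trans _ (Lp_ge0 _)).
have ffin := Lp_fin_num mf f0; have gfin := Lp_fin_num mg g0.
rewrite ltey in ffin; rewrite ltey in gfin.
have {foo}ffin := ffin foo; have {goo}gfin := gfin goo.
have fgfin : {ae mu, forall x, D x -> f x + g x \is a fin_num}.
  by apply: filterS2 ffin gfin => x fx gx Dx; rewrite fin_numD fx ?gx.
have mfine (k : T -> \bar R) : measurable_fun D k ->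
    measurable_fun [set: T] ((fine \o k) \_ D).
  move=> mk; apply/(measurable_restrictT _ mD).
  exact: measurableT_comp.
rewrite !Lp_Lnorm//; apply: le_trans (minkowski_EFin _ _ _ _) => //;
  [|exact: mfine|exact: mfine].
have pw (k : T -> R) : measurable_fun setT k ->
    measurable_fun setT (fun x => `|k x|%:E `^ p).
  move=> mk; apply: (measurableT_comp (measurable_poweR p)).
  by apply/measurable_EFinP; exact: measurableT_comp.
rewrite unlock; apply: le_poweR; first by rewrite invr_ge0 ltW.
  by apply: integral_ge0 => x _; exact: poweR_ge0.
apply: ae_ge0_le_integral => //.
- by move=> x _; exact: poweR_ge0.
- by apply: pw; exact: mfine.
- by move=> x _; exact: poweR_ge0.
- by apply: pw; apply: measurable_funD; exact: mfine.
apply: filterS2 ffin gfin => x fx gx _; rewrite /= !patchE.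
case: ifPn => [/set_mem Dx|_]; last by rewrite addr0.
by rewrite /= fineD ?fx ?gx.
Qed.

(** Fatou's lemma for the [p]-th powers. The hypothesis on [y < f x] says that [f] is at most the
    lower limit of the [F n]. *)
Lemma Lp_liminf f (F : nat -> T -> \bar R) (c : \bar R) :
  measurable_fun D f -> (forall n, measurable_fun D (F n)) ->
  (forall x, D x -> 0 <= f x) -> (forall n x, D x -> 0 <= F n x) ->
  (forall x y, D x -> y < f x -> exists N,
    forall n, (N <= n)%N -> y <= F n x) ->
  (forall n, Lp (F n) <= c) -> Lp f <= c.
Proof.
move=> mf mF f0 F0 fF Fc.
have c0 : 0 <= c by exact: le_trans (Lp_ge0 _) (Fc 0%N).
have inf_le (u : nat -> \bar R) (C : \bar R) :
    (forall n, u n <= C) -> limn_einf u <= C.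
  move=> uC; rewrite limn_einf_lim; apply: lime_le; first exact: is_cvg_einfs.
  by apply: nearW => n; apply: ge_ereal_inf; exists (u n) => //; exists n => /=.
have inf_ge (u : nat -> \bar R) (C : \bar R) N :
    (forall n, (N <= n)%N -> C <= u n) -> C <= limn_einf u.
  move=> uC; rewrite limn_einf_lim; apply: lime_ge; first exact: is_cvg_einfs.
  exists N => // n /= Nn; apply: le_ereal_inf_tmp => _ [k /= nk <-].
  by apply: uC; exact: leq_trans nk.
have mG : measurable_fun D (fun x => limn_einf (fun n => F n x `^ p)).
  apply: measurableT_comp => //; apply: measurable_fun_limn_esup => n.
  by apply: measurableT_comp => //; exact: measurable_pow.
have key : \int[mu]_(x in D) (f x `^ p) <=
    \int[mu]_(x in D) limn_einf (fun n => F n x `^ p).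
  apply: ge0_le_integral => //.
  - by move=> x _; exact: poweR_ge0.
  - exact: measurable_pow.
  move=> x Dx; set L := limn_einf _.
  have L0 : 0 <= L by apply: (@inf_ge _ _ 0%N) => n _; exact: poweR_ge0.
  rewrite -[L]poweRe1// -(@mulVf _ p) ?gt_eqF// poweRrM.
  apply: le_poweR; rewrite ?invr_ge0 ?(ltW p0) ?f0//.
  (* Otherwise some [y] lies strictly between [L^(1/p)] and [f x]; then [F n x] is eventually at
     least [y], so [y^p <= L], a contradiction. *)
  rewrite leNgt; apply/negP => /(ge0_lte_dense (poweR_ge0 _ _))[y /andP[Ly yf]].
  have [N FN] := fF _ _ Dx yf.
  have y0 : 0 <= y by apply: le_trans (ltW Ly); exact: poweR_ge0.
  suff : y <= L `^ p^-1 by rewrite leNgt Ly.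
  rewrite -[y]poweRe1// -(@mulfV _ p) ?gt_eqF// poweRrM.
  apply: le_poweR; rewrite ?invr_ge0 ?(ltW p0) ?poweR_ge0//.
  by apply: (@inf_ge _ _ N) => n Nn; apply: le_poweR; rewrite ?(ltW p0) ?FN.
rewrite /Lp -[leRHS]poweRe1// -(@mulfV _ p) ?gt_eqF// poweRrM.
apply: le_poweR => //; first by rewrite invr_ge0 ltW.
apply: (le_trans key); apply: le_trans (fatou _ _ _ _) _ => //.
- by move=> n; exact: measurable_pow.
- by move=> n x Dx; exact: poweR_ge0.
apply: inf_le => n; rewrite -poweR_Lp.
by apply: le_poweR; rewrite ?(ltW p0) ?Lp_ge0 ?Fc.
Qed.

(** Minkowski's inequality, iterated, bounds the partial sums, and [Lp_liminf] passes to the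
    limit. *)
Lemma Lp_nneseries (F : nat -> T -> \bar R) N :
  (forall n, measurable_fun D (F n)) -> (forall n x, D x -> 0 <= F n x) ->
  Lp (fun x => \sum_(N <= i <oo) F i x) <= \sum_(N <= i <oo) Lp (F i).
Proof.
move=> mF F0.
have mS n : measurable_fun D (fun x => \sum_(N <= i < n) F i x).
  exact: emeasurable_sum.
have S0 n x : D x -> 0 <= \sum_(N <= i < n) F i x.
  by move=> Dx; apply: sume_ge0 => i _; exact: F0.
apply: (@Lp_liminf _ (fun n x => \sum_(N <= i < n) F i x)) => //.
- apply: (emeasurable_fun_cvg (fun n x => \sum_(N <= i < n) F i x)) => //.
  by move=> x Dx; apply: is_cvg_nneseries => i _ _; exact: F0.
- by move=> x Dx; apply: nneseries_ge0 => i _ _; exact: F0.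
- move=> x y Dx.
  have nd : nondecreasing_seq (fun n => \sum_(N <= i < n) F i x).
    by apply: ereal_nondecreasing_series => i _ _; exact: F0.
  have /cvg_lim -> // := ereal_nondecreasing_cvgn nd.
  move=> /ereal_sup_gt[_ [k _ <-] yk]; exists k => n kn.
  exact: le_trans (ltW yk) (nd _ _ kn).
move=> n; apply: le_trans (nneseries_lim_ge n _); last first.
  by move=> i _ _; exact: Lp_ge0.
have L0 : Lp (fun=> 0) = 0.
  rewrite /Lp integral0_eq; first by rewrite poweR0r.
  by move=> x _; rewrite poweR0r ?gt_eqF.
elim: n => [|n ih].
  by rewrite big_geq// (eq_Lp (g := fun=> 0)) ?L0// => x _; rewrite big_geq.
have [Nn|nN] := leqP N n; last first.
  by rewrite big_geq// (eq_Lp (g := fun=> 0)) ?L0// => x _; rewrite big_geq.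
rewrite big_nat_recr//=.
apply: le_trans (leeD2r _ ih); apply: Lp_le_add => //.
- by move=> x Dx; exact: S0.
- by move=> x Dx; exact: F0.
- by move=> x Dx; exact: S0.
by apply: aeW => x Dx; rewrite big_nat_recr.
Qed.


End Lp.

(** * The metric and density *)

Section FuzzyMetric.
Context {R : realType} {m : nat} {p : R}.
Hypothesis p1 : 1 <= p.
Implicit Types u v w : 'rV[R]_m -> R.
Local Notation mu := (@lebesgue_measure R).
Local Notation I := (`[0%R, 1%R]%classic : set R).

Let p0 : 0 < p. Proof. exact: lt_le_trans p1. Qed.
Let pV0 : p^-1 != 0. Proof. by rewrite invr_eq0 gt_eqF. Qed.
Let mI : measurable I. Proof. exact: measurable_itv. Qed.

Lemma unit_itv_bounds (a : R) : I a -> 0 <= a <= 1.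
Proof. by rewrite /= in_itv. Qed.

Lemma dpE u v :
  dp p u v = Lp mu I p (fun a => hausdorff (cut u a) (cut v a)).
Proof. by []. Qed.

Lemma dp_ge0 u v : (0 <= dp p u v)%E.
Proof. exact: poweR_ge0. Qed.

Lemma dp_sym u v : dp p u v = dp p v u.
Proof. by rewrite !dpE; apply: eq_Lp => a _; rewrite hausdorff_sym. Qed.

Lemma hausdorff_cut_ge0 u v (a : R) : normal_fuzzy u -> normal_fuzzy v -> I a ->
  (0 <= hausdorff (cut u a) (cut v a))%E.
Proof.
by move=> nu nv /unit_itv_bounds a01; apply: hausdorff_ge0; exact: cut_neq0.
Qed.

Lemma dp_triangle v u w : normal_fuzzy u -> normal_fuzzy v -> normal_fuzzy w ->
  (dp p u w <= dp p u v + dp p v w)%E.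
Proof.
move=> nu nv nw; rewrite !dpE; apply: Lp_le_add => //.
all: try by move=> a; exact: hausdorff_cut_ge0.
all: try exact: measurable_hausdorff_cut.
apply: aeW => a /unit_itv_bounds a01.
by apply: hausdorff_triangle; exact: cut_neq0.
Qed.

Lemma dpxx u : normal_fuzzy u -> dp p u u = 0%E.
Proof.
move=> nu; rewrite dpE /Lp integral0_eq; first by rewrite poweR0r.
move=> a /unit_itv_bounds a01.
by rewrite hausdorffxx ?poweR0r ?gt_eqF//; exact: cut_neq0.
Qed.

Lemma dp_originE u : dp p u fuzzy_origin =
  ((\int[lebesgue_measure]_(a in `[0%R, 1%R])
      (hausdorff (cut u a) [set 0%R]) `^ p) `^ p^-1)%E.
Proof.
apply: eq_Lp => a; rewrite inE => /unit_itv_bounds a01.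
by rewrite cut_fuzzy_origin.
Qed.

Lemma Smp_normal u : fuzzy_Smp p u -> normal_fuzzy u.
Proof. by case. Qed.

Lemma Smp_dp_origin u : fuzzy_Smp p u -> (dp p u fuzzy_origin < +oo)%E.
Proof. by rewrite dp_originE; case. Qed.

Lemma dp_fin u v : fuzzy_Smp p u -> fuzzy_Smp p v -> (dp p u v < +oo)%E.
Proof.
move=> Su Sv; apply: (le_lt_trans (@dp_triangle fuzzy_origin _ _ _ _ _)).
- exact: Smp_normal.
- exact: normal_fuzzy_origin.
- exact: Smp_normal.
by rewrite (dp_sym fuzzy_origin) lte_add_pinfty// Smp_dp_origin.
Qed.

(** A null set cannot contain a nonempty open interval, which has positive measure. *)
Lemma ae_exists_itv (P : R -> Prop) (x y : R) :
  {ae mu, forall a, P a} -> x < y -> exists2 a, x < a < y & P a.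
Proof.
move=> [N [mN N0 PN]] xy; apply: contrapT => h.
have xyN : `]x, y[%classic `<=` N.
  move=> a /=; rewrite in_itv/= => axy; apply: PN => /= Pa.
  by apply: h; exists a.
have : (mu `]x, y[%classic <= mu N)%E.
  by apply: le_measure; rewrite ?inE//; exact: measurable_itv.
rewrite [X in (_ <= X)%E]N0 lebesgue_measure_itv/= lte_fin xy.
rewrite -EFinD lee_fin leNgt.
by rewrite subr_gt0 xy.
Qed.

Lemma dp_eq0_ae u v : normal_fuzzy u -> normal_fuzzy v -> dp p u v = 0%E ->
  {ae mu, forall a, I a -> hausdorff (cut u a) (cut v a) = 0%E}.
Proof.
move=> nu nv /(poweR_eq0_eq0 (integral_ge0 _ (fun x _ => poweR_ge0 _ _))) h.
have mh : measurable_fun I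
    (fun a => (hausdorff (cut u a) (cut v a) `^ p)%E).
  apply: (measurableT_comp (measurable_poweR p)).
  exact: measurable_hausdorff_cut.
have /(ae_eq_integral_abs mu mI mh) : (\int[mu]_(a in I)
    `|hausdorff (cut u a) (cut v a) `^ p| = 0)%E.
  by under eq_integral do rewrite gee0_abs ?poweR_ge0//.
apply: filterS => a ha Ia; apply: (@poweR_eq0_eq0 _ _ p).
  exact: hausdorff_cut_ge0.
exact: ha.
Qed.

(** If [w x < z x], some level [a] in between has cuts at distance zero. Then [x] is in the cut of
    [z], hence at distance zero from that of [w], and upper semicontinuity gives [a <= w x]. *)
Lemma dp_eq0 u v : fuzzy_Smp p u -> fuzzy_Smp p v -> dp p u v = 0%E -> u = v.
Proof.
have key w z : fuzzy_Smp p w -> fuzzy_Smp p z -> dp p w z = 0%E ->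
    forall x, z x <= w x.
  move=> [fw nw uscw _ _] [fz nz uscz _ _] /(dp_eq0_ae nw nz) h x.
  rewrite leNgt; apply/negP => /(ae_exists_itv h)[a /andP[wa az] ha].
  have /andP[w0 _] := fw x; have /andP[_ z1] := fz x.
  have a0 : 0 < a by exact: le_lt_trans wa.
  have a1 : a <= 1 by exact: le_trans (ltW az) _.
  have := @hausdorff_ge _ _ (cut w a) (cut z a) x.
  rewrite ha/=; last by rewrite in_itv/= (ltW a0).
  rewrite (dist_mem (A := cut z a)); last by rewrite cutE//= ltW.
  rewrite subr0 lee_fin normr_le0 => /(_ _ _)/eqP h0.
  have : a <= w x.
    apply: dist_cut_mem => //; first by rewrite a0.
    by apply: h0; apply: cut_neq0 => //; rewrite (ltW a0).
  by rewrite leNgt wa.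
move=> Su Sv uv; apply/funext => x; apply/eqP; rewrite eq_le !key//.
by rewrite dp_sym.
Qed.

Lemma metric_on_Smp : metric_on (@fuzzy_Smp R m p) (@dp R m p).
Proof.
split.
- by move=> u v Su Sv; rewrite dp_ge0 dp_fin.
- move=> u v Su Sv; split; first exact: dp_eq0.
  by move=> <-; apply: dpxx; exact: Smp_normal.
- by move=> u v _ _; exact: dp_sym.
- by move=> u v w Su Sv Sw; apply: dp_triangle; exact: Smp_normal.
Qed.

Lemma Smp_of_dp_origin u : fuzzy_set u -> normal_fuzzy u ->
  upper_semicontinuous u -> fuzzy_star_shaped u ->
  (dp p u fuzzy_origin < +oo)%E -> fuzzy_Smp p u.
Proof. by rewrite dp_originE. Qed.

Lemma Sm_sub_Smp : @fuzzy_Sm R m `<=` @fuzzy_Smp R m p.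
Proof.
move=> u [fu nu uscu [M [_ Mu]] su]; apply: Smp_of_dp_origin => //.
(* [bounded_set] bounds the max norm by every number above [M], such as [|M| + 1]; the factor [m]
   passes to the Euclidean distance. *)
pose C : R := m%:R * (`|M| + 1).
have hC a : I a -> (hausdorff (cut u a) (cut fuzzy_origin a) <= C%:E)%E.
  move=> /unit_itv_bounds a01; rewrite cut_fuzzy_origin//.
  apply: hausdorff0_le; first exact: cut_neq0.
  move=> x ux; apply: (le_trans (edist_le_norm _ _)); rewrite ler_wpM2l//.
  rewrite subr0; apply: Mu; first by rewrite (le_lt_trans (ler_norm _))// ltrDl.
  by apply: cut_subset ux => //; case/andP: a01.
rewrite dpE /Lp; apply: poweR_lty.
apply: (@le_lt_trans _ _ (\int[mu]_(a in I) (C%:E `^ p))%E).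
  apply: ge0_le_integral => //.
  - by move=> a _; exact: poweR_ge0.
  - apply: (measurableT_comp (measurable_poweR p)).
    exact: measurable_hausdorff_cut normal_fuzzy_origin.
  - move=> a Ia; apply: le_poweR; rewrite ?(ltW p0) ?hC//.
    exact: hausdorff_cut_ge0 normal_fuzzy_origin _.
rewrite integral_cst//= lebesgue_measure_itv/= lte_fin ltr01.
by rewrite sube0 mule1 ltry.
Qed.

(** * Bounded cuts, truncation and density *)

Lemma dp_fin_ae u v : normal_fuzzy u -> normal_fuzzy v -> (dp p u v < +oo)%E ->
  {ae mu, forall a, I a -> hausdorff (cut u a) (cut v a) \is a fin_num}.
Proof.
move=> nu nv; rewrite dpE => uv.
apply: Lp_fin_num uv => //; first exact: measurable_hausdorff_cut.
by move=> a; exact: hausdorff_cut_ge0.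
Qed.

(** Finiteness of the norm yields a level below [t] whose cut is at finite distance from the origin;
    that cut contains the one at [t]. *)
Lemma Smp_cut_bounded u (t : R) : fuzzy_Smp p u -> 0 < t <= 1 ->
  exists M : R, forall y, cut u t y -> edist y 0 <= M.
Proof.
move=> Su /andP[t0 t1]; have nu := Smp_normal Su.
have := dp_fin_ae nu normal_fuzzy_origin (Smp_dp_origin Su).
move=> /ae_exists_itv /(_ t0)[a /andP[a0 at1]] hfin.
have a01 : 0 <= a <= 1 by rewrite (ltW a0)/= (le_trans (ltW at1)).
exists (fine (hausdorff (cut u a) [set 0])) => y uty.
rewrite -lee_fin fineK; last by rewrite -(cut_fuzzy_origin a01) hfin//= in_itv.
by apply: hausdorff0_ge; apply: cut_subset uty; exact: ltW.
Qed.

Lemma closed_cut u (t : R) : upper_semicontinuous u -> 0 < t ->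
  closed (cut u t).
Proof.
move=> usc t0; rewrite cutE// -[X in closed X]setCK; apply: open_closedC.
rewrite openE => x /= /negP; rewrite -ltNge => /usc.
by apply: filterS => y /=; rewrite ltNge => /negP.
Qed.

(** Keeping the value [t] itself makes the support equal to [cut u t] for positive [t]. This set is
    closed when [u] is upper semicontinuous, so the closure at level 0 adds nothing. *)
Definition truncate (t : R) u : 'rV[R]_m -> R :=
  fun x => if t <= u x then u x else 0.

Lemma cut_truncate (t a : R) u : upper_semicontinuous u -> 0 < t -> 0 <= a ->
  cut (truncate t u) a = cut u (Num.max t a).
Proof.
move=> usc t0; rewrite le_eqVlt => /predU1P[<-|a0].
  rewrite max_l ?(ltW t0)// [LHS]/cut eqxx.
  rewrite [RHS](closure_id _).1; last exact: closed_cut.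
  congr closure; rewrite cutE//; apply/seteqP; split => x /=; rewrite /truncate.
    by case: ifPn => //; rewrite ltxx.
  by move=> tux; rewrite tux (lt_le_trans t0).
rewrite !cutE ?lt_max ?t0//; apply/seteqP; split => x /=; rewrite /truncate.
  case: ifPn => [tu au|_]; first by rewrite ge_max tu.
  by rewrite leNgt a0.
by rewrite ge_max => /andP[tu au]; rewrite tu.
Qed.

Lemma truncate_Sm (t : R) u : fuzzy_Smp p u -> 0 < t <= 1 ->
  fuzzy_Sm (truncate t u).
Proof.
move=> Su /andP[t0 t1]; have [fu [x0 ux0] usc _ [c cP]] := Su; split.
- by move=> x; rewrite /truncate; case: ifPn; rewrite ?fu// lexx ler01.
- by exists x0; rewrite /truncate ux0 t1.
- move=> x a; rewrite /truncate; case: ifPn => [tu ua|].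
    have := usc _ _ ua; apply: filterS => y uya; case: ifPn => // _.
    by apply: le_lt_trans ua; case/andP: (fu x).
  rewrite -ltNge => /usc ut a0; move: ut; apply: filterS => y uyt.
  by rewrite leNgt uyt.
- rewrite cut_truncate// max_l ?(ltW t0)//.
  have [|M MP] := @Smp_cut_bounded _ t Su; first by rewrite t0.
  exists M; split; first exact: num_real.
  move=> K MK y /= /MP yM; rewrite -[y]subr0.
  exact: le_trans (norm_le_edist _ _) (le_trans yM (ltW MK)).
(* A star center of [u] still works: segments towards it from points of height at least [t] stay at
   height at least [t]. *)
exists c => y l l01; rewrite /truncate; case: ifPn => [tu|_].
  by rewrite (le_trans tu (cP y l l01)) cP.
by case: ifPn => // _; case/andP: (fu (l *: y + (1 - l) *: c)).
Qed.

Lemma dense_Sm_Smp : dense_in (@fuzzy_Sm R m) (@fuzzy_Smp R m p) (@dp R m p).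
Proof.
move=> u Su e e0; have [fu nu usc _ _] := Su.
pose t (n : nat) : R := n.+1%:R^-1.
have t0 n : 0 < t n by rewrite invr_gt0.
have t1 n : t n <= 1 by rewrite invf_le1// ler1n.
have St n : fuzzy_Sm (truncate (t n) u) by apply: truncate_Sm; rewrite ?t0 ?t1.
have nt n : normal_fuzzy (truncate (t n) u) by have [] := St n.
pose h a := hausdorff (cut u a) (cut fuzzy_origin a).
pose f n a := hausdorff (cut (truncate (t n) u) a) (cut u a).
have mh : measurable_fun I h.
  exact: measurable_hausdorff_cut normal_fuzzy_origin.
have h0 a : I a -> (0 <= h a)%E.
  exact: hausdorff_cut_ge0 normal_fuzzy_origin.
have mf n : measurable_fun I (f n) by exact: measurable_hausdorff_cut.
have f0 n a : I a -> (0 <= f n a)%E by exact: hausdorff_cut_ge0.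
(* The comparison goes through the origin: the truncated cut lies in the cut of [u], hence reaches
   no farther. *)
have fh n a : I a -> (f n a <= h a + h a)%E.
  move=> /unit_itv_bounds/[dup] a01 /andP[a0 a1].
  apply: le_trans (@hausdorff_triangle _ _ [set 0] _ _ _ _ _) _.
  - exact: cut_neq0.
  - by exists 0.
  - exact: cut_neq0.
  rewrite /h cut_fuzzy_origin// [X in (_ + X)%E]hausdorff_sym leeD2r//.
  apply: hausdorff0_subset; first exact: cut_neq0.
  by rewrite cut_truncate//; apply: cut_subset; rewrite // le_max lexx orbT.
have mpow (k : R -> \bar R) : measurable_fun I k ->
    measurable_fun I (fun a => (k a `^ p)%E).
  exact: (measurableT_comp (measurable_poweR p)).
have mhh : measurable_fun I (fun a => h a + h a)%E by exact: emeasurable_funD.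
have [] := @dominated_convergence _ _ _ mu I mI (fun n a => (f n a `^ p)%E)
  (fun=> 0%E) (fun a => ((h a + h a) `^ p)%E) _ _ _ _ _.
- by move=> n; exact: mpow.
- exact: measurable_cst.
(* Level 0 is set aside: [t n] falls below [a], leaving the cut at [a] unchanged, only when [a] is
   positive. *)
- exists [set 0]; split; [exact: measurable_set1|exact: lebesgue_measure_set1|].
  move=> a /= na; apply: contrapT => a0; apply: na => Ia.
  have /andP[a0' a1] := unit_itv_bounds Ia.
  have {a0}a0 : 0 < a by rewrite lt_neqAle a0' andbT eq_sym; apply/eqP.
  apply: cvg_near_cst.
  have : \forall n \near \oo, t n < a.
    have := cvg_harmonic (R := R).
    by move=> /cvgrPdist_lt /(_ _ a0); apply: filterS => n;
      rewrite sub0r normrN ger0_norm// ltW.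
  apply: filterS => n /ltW tna; rewrite /f cut_truncate// max_r//.
  by rewrite hausdorffxx ?poweR0r ?gt_eqF//; exact: cut_neq0.
- apply/integrableP; split; first exact: mpow.
  under eq_integral do rewrite gee0_abs ?poweR_ge0//.
  rewrite -(@poweR_Lp _ _ _ mu I p p1 (fun a => h a + h a)%E); apply: poweR_lty.
  apply: (@le_lt_trans _ _ (dp p u fuzzy_origin + dp p u fuzzy_origin)%E).
    rewrite !dpE; apply: Lp_le_add => //.
    - by move=> a Ia; rewrite adde_ge0 ?h0.
    by apply: aeW => a _.
  by rewrite lte_add_pinfty ?Smp_dp_origin.
- apply: aeW => a n Ia; rewrite gee0_abs ?poweR_ge0//.
  by apply: le_poweR; rewrite ?(ltW p0) ?f0 ?fh.
move=> _ _; rewrite integral0.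
have ep : (0 < e%:E `^ p)%E by rewrite poweR_gt0// lte_fin.
move=> /(_ _ (open_ereal_lt' ep))[n _ /(_ n (leqnn _))/= fn].
exists (truncate (t n) u); first exact: St.
rewrite ltNge; apply/negP => /(le_poweR (ltW p0)).
rewrite lee_fin (ltW e0) => /(_ isT); rewrite dpE poweR_Lp// leNgt.
by rewrite fn.
Qed.

End FuzzyMetric.

(** * Limits of fuzzy star-shaped numbers *)

Section FuzzyLimit.
Context {R : realType} {m : nat}.
Local Notation mu := (@lebesgue_measure R).
Local Notation I := (`[0%R, 1%R]%classic : set R).
(** [E] contains almost all levels; at each of them [t k a] tends to 0 and bounds, uniformly in the
    point, how far the [k]-th cut is from all later ones. *)
Variables (v : nat -> 'rV[R]_m -> R) (E : set R) (t : nat -> R -> R).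
Implicit Types (x y q : 'rV[R]_m) (a b e : R).
Hypotheses (nv : forall k, normal_fuzzy (v k))
  (sv : forall k, fuzzy_star_shaped (v k))
  (bv : forall k a, 0 < a <= 1 ->
    exists M : R, forall y, cut (v k) a y -> edist y 0 <= M)
  (E01 : forall a, E a -> 0 < a <= 1)
  (Eae : {ae mu, forall a, I a -> E a})
  (t_cvg0 : forall a, E a -> forall e, 0 < e ->
    exists N, forall k, (N <= k)%N -> t k a <= e)
  (cauchy_cuts : forall a, E a -> forall k j, (k <= j)%N -> forall x,
    `|dist (cut (v k) a) x - dist (cut (v j) a) x| <= t k a).

Let cutv_neq0 k a : 0 < a <= 1 -> cut (v k) a !=set0.
Proof. by move=> /andP[a0 a1]; apply: cut_neq0; rewrite ?(ltW a0). Qed.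

Let t_ge0 k a : E a -> 0 <= t k a.
Proof. by move=> /cauchy_cuts /(_ _ _ (leqnn k) 0); exact: le_trans. Qed.

(* Kuratowski lower limit of the cuts at a common level. *)
Definition lim_cut b : set 'rV[R]_m := [set x |
  forall e, 0 < e -> exists N, forall k, (N <= k)%N ->
    dist (cut (v k) b) x <= e].

(** The extra value 0 keeps the set nonempty when [x] lies in no limit cut. *)
Definition lim_fuzzy x : R :=
  sup [set b | b = 0 \/ (0 < b <= 1 /\ lim_cut b x)].

Lemma lim_cut_le b b' : 0 < b -> b <= b' -> b' <= 1 ->
  lim_cut b' `<=` lim_cut b.
Proof.
move=> b0 bb' b1 x + e e0 => /(_ _ e0)[N NP]; exists N => k /NP.
apply: le_trans; apply: dist_subset.
  by apply: cutv_neq0; rewrite (lt_le_trans b0).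
by apply: cut_subset => //; exact: ltW.
Qed.

(** At a level of [E] the distances are Cauchy, so closeness to infinitely many cuts gives closeness
    to all late ones. Cluster points enter the limit cuts this way. *)
Lemma lim_cut_frequently b x : E b ->
  (forall e N, 0 < e -> exists2 k, (N <= k)%N & dist (cut (v k) b) x <= e) ->
  lim_cut b x.
Proof.
move=> Eb freq e e0; have e2 : 0 < e / 2 by rewrite divr_gt0.
have [N NP] := t_cvg0 Eb e2; have [k Nk kx] := freq _ N e2.
exists k => j kj; have := cauchy_cuts Eb kj x; have := NP _ Nk.
by rewrite ler_norml => ? /andP[? ?]; lra.
Qed.

Lemma lim_cut_closed b x : 0 < b <= 1 ->
  (forall e, 0 < e -> exists2 y, lim_cut b y & edist x y <= e) -> lim_cut b x.
Proof.
move=> b01 xb e e0; have e2 : 0 < e / 2 by rewrite divr_gt0.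
have [y /(_ _ e2)[N NP] xy] := xb _ e2; exists N => k /NP yk.
by have := dist_lipschitz x y (cutv_neq0 k b01); lra.
Qed.

Let lim_fuzzy_ubound x :
  has_ubound [set b | b = 0 \/ (0 < b <= 1 /\ lim_cut b x)].
Proof. by exists 1 => b [->|[/andP[]]]. Qed.

Lemma fuzzy_set_lim : fuzzy_set lim_fuzzy.
Proof.
move=> x; apply/andP; split; first by apply: ub_le_sup => //; left.
by apply: ge_sup => [|b [->|[/andP[]]]]//; exists 0; left.
Qed.

Lemma lim_cut_lim_fuzzy b x : 0 < b <= 1 -> lim_cut b x -> b <= lim_fuzzy x.
Proof. by move=> b01 bx; apply: ub_le_sup => //; right. Qed.

(** Some level above [b] has [x] in its limit cut, and limit cuts shrink as the level grows. *)
Lemma lt_lim_fuzzy b x : 0 < b -> b < lim_fuzzy x -> lim_cut b x.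
Proof.
move=> b0 /sup_gt[|b' [b'0|[/andP[b'0 b'1] b'x]] bb'].
- by exists 0; left.
- by move: bb'; rewrite b'0 ltNge (ltW b0).
- exact: (lim_cut_le b0 (ltW bb') b'1).
Qed.

Lemma E_between a a' : 0 <= a -> a < 1 -> a < a' -> exists2 b, a < b < a' & E b.
Proof.
(* [E] is only known to fill the unit interval, so the search is capped at 1. *)
move=> a0 a1 aa'; have : a < Num.min a' 1 by rewrite lt_min aa'.
move=> /(ae_exists_itv Eae)[b /andP[ab]]; rewrite lt_min => /andP[ba' b1] Eb.
exists b; first by rewrite ab.
by apply: Eb; rewrite /= in_itv/= (ltW (le_lt_trans a0 ab)) ltW.
Qed.

(** Levels of [E] are dense, so a gap between [lim_fuzzy x] and [c] would contain one of them. *)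
Lemma le_lim_fuzzy x c : (forall b, E b -> b < c -> lim_cut b x) -> c <= 1 ->
  c <= lim_fuzzy x.
Proof.
move=> bx c1; rewrite leNgt; apply/negP => uc.
have /andP[u0 _] := fuzzy_set_lim x.
have [b /andP[ub bc] Eb] := E_between u0 (lt_le_trans uc c1) uc.
by have := lim_cut_lim_fuzzy (E01 Eb) (bx _ Eb bc); rewrite leNgt ub.
Qed.

(** For [b] in [E] strictly between [lim_fuzzy x] and [a], points of height at least [a] lie in
    [lim_cut b]. If they accumulated at [x], closedness would put [x] there too, forcing
    [b <= lim_fuzzy x]. *)
Lemma upper_semicontinuous_lim : upper_semicontinuous lim_fuzzy.
Proof.
move=> x a ua; have [a1|a1] := ltP 1 a.
  apply/near_edist; exists 1 => // y _; apply: le_lt_trans a1.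
  by case/andP: (fuzzy_set_lim y).
have /andP[u0 _] := fuzzy_set_lim x.
have [b /andP[ub ba] Eb] := E_between u0 (lt_le_trans ua a1) ua.
have b01 := E01 Eb; have /andP[b0 _] := b01.
apply/near_edist; apply: contrapT => h.
have : lim_cut b x; last first.
  by move=> /(lim_cut_lim_fuzzy b01); rewrite leNgt ub.
apply: lim_cut_closed => // e e0; apply: contrapT => h'; apply: h.
exists e => // y xy; rewrite ltNge; apply/negP => ay; apply: h'.
by exists y; [exact: lt_lim_fuzzy (lt_le_trans ba ay)|exact: ltW].
Qed.

Let centers : exists c : nat -> 'rV[R]_m, forall k,
  v k (c k) >= 1 /\ forall y (l : R), 0 <= l <= 1 ->
    v k y <= v k (l *: y + (1 - l) *: c k).
Proof.
suff h k : exists c, v k c >= 1 /\ forall y (l : R), 0 <= l <= 1 ->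
    v k y <= v k (l *: y + (1 - l) *: c) by have [c cP] := choice h; exists c.
have [c cP] := sv k; exists c; split => //.
(* The case [l = 0] compares the center with a point of height 1. *)
have [x0 <-] := nv k; have := cP x0 0; rewrite lexx ler01 => /(_ isT).
by rewrite scale0r add0r subr0 scale1r.
Qed.

(** Star centers of the [v k] lie in all their cuts. At one level of [E] these cuts stay close to
    the bounded cut of [v 0], so the centers are bounded and have a cluster point. *)
Lemma lim_fuzzy_center : exists c, (forall b, E b -> lim_cut b c) /\
  forall y (l : R), 0 <= l <= 1 -> forall b, E b -> lim_cut b y ->
    lim_cut b (l *: y + (1 - l) *: c).
Proof.
have [c cP] := centers.
have c_cut k b : E b -> cut (v k) b (c k).
  move=> /E01/andP[b0 b1]; rewrite cutE//=; apply: le_trans b1 _.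
  by have [] := cP k.
have [b0 /andP[_ _] Eb0] := E_between (lexx 0) ltr01 ltr01.
have b01 := E01 Eb0; have [M MP] := bv 0 b01.
have [k _|x xP] := @bounded_seq_cluster _ _ c (t 0 b0 + 1 + M) 0.
  have : dist (cut (v 0) b0) (c k) < t 0 b0 + 1.
    have := cauchy_cuts Eb0 (leq0n k) (c k).
    rewrite [X in _ - X]dist_mem; last exact: c_cut.
    by rewrite subr0 ler_norml => /andP[_]; lra.
  move=> /(dist_lt (cutv_neq0 0 b01))[a /MP aM ca].
  by have := edist_triangle a (c k) 0; lra.
exists x; split=> [b Eb|y l l01 b Eb yb].
  apply: lim_cut_frequently => // e N /xP => /(_ N)[k Nk xk]; exists k => //.
  apply: le_trans (dist_le _ (c_cut k b Eb)) _; exact: ltW.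
apply: lim_cut_frequently => // e N e0.
(* One third is for the distance from [y] to the cut, one for a point [a] nearly attaining it, one
   for the distance from [c k] to the cluster point. *)
have e3 : 0 < e / 3 by rewrite divr_gt0.
have [N1 N1P] := yb _ e3.
have [k Nk xk] := xP (e / 3) (maxn N N1) e3.
have [NNk N1k] : (N <= k)%N /\ (N1 <= k)%N by apply/andP; rewrite -geq_max.
exists k => //.
have : dist (cut (v k) b) y < e / 3 + e / 3 by have := N1P _ N1k; lra.
move=> /(dist_lt (cutv_neq0 k (E01 Eb)))[a ka ya].
have := @dist_le _ _ (cut (v k) b) (l *: a + (1 - l) *: c k)
  (l *: y + (1 - l) *: x).
have /andP[b0' _] := E01 Eb.
have la : cut (v k) b (l *: a + (1 - l) *: c k).
  move: ka; rewrite !cutE//= => ba; apply: le_trans ba _.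
  by have [_ ->] := cP k.
by move=> /(_ la); have := edist_convex x y (c k) a l01; lra.
Qed.

Lemma normal_fuzzy_lim : normal_fuzzy lim_fuzzy.
Proof.
have [c [cE _]] := lim_fuzzy_center; exists c; apply/eqP; rewrite eq_le.
have /andP[_ ->] := fuzzy_set_lim c.
by apply: le_lim_fuzzy => // b Eb _; exact: cE.
Qed.

Lemma fuzzy_star_shaped_lim : fuzzy_star_shaped lim_fuzzy.
Proof.
have [c [_ cE]] := lim_fuzzy_center; exists c => y l l01.
apply: le_lim_fuzzy; last by case/andP: (fuzzy_set_lim y).
move=> b Eb yb; apply: cE => //; apply: lt_lim_fuzzy => //.
by case/andP: (E01 Eb).
Qed.

(* On [E] this is the limit of the distances to the cuts. *)
Let lim_dist x b : R := inf (range (fun k => dist (cut (v k) b) x + t k b)).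

(** Writing [d_k] for the distance to the [k]-th cut, the Cauchy bound gives
    [d_k - t_k <= d_j + t_j] for all [j] and [k], so each [d_k - t_k] bounds the range from
    below. *)
Let lim_distP x b k : E b -> `|dist (cut (v k) b) x - lim_dist x b| <= t k b.
Proof.
move=> Eb; have lb : lbound (range (fun k => dist (cut (v k) b) x + t k b))
    (dist (cut (v k) b) x - t k b).
  move=> _ [j _ <-]; have := t_ge0 j Eb; have := t_ge0 k Eb.
  have [kj|/ltnW jk] := leqP k j.
    by have := cauchy_cuts Eb kj x; rewrite ler_norml => /andP[_]; lra.
  by have := cauchy_cuts Eb jk x; rewrite ler_norml => /andP[+ _]; lra.
have h1 : lim_dist x b <= dist (cut (v k) b) x + t k b.
  by apply: ge_inf; [exists (dist (cut (v k) b) x - t k b)|exists k].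
have h2 : dist (cut (v k) b) x - t k b <= lim_dist x b.
  by apply: lb_le_inf => //; exists (dist (cut (v k) b) x + t k b), k.
by rewrite ler_norml; lra.
Qed.

(** Nearly closest points [a k] in the cuts of the [v k] are bounded; a cluster point of them lies
    in [lim_cut b], hence in the cut of [lim_fuzzy], and its distance to [x] exceeds the limit by
    less than [e]. *)
Let dist_lim_le x b : E b -> dist (cut lim_fuzzy b) x <= lim_dist x b.
Proof.
move=> Eb; have b01 := E01 Eb; have /andP[b0 b1] := b01.
apply/ler_addgt0Pr => e e0; have e4 : 0 < e / 4 by rewrite divr_gt0.
have [a aP] : exists a : nat -> 'rV[R]_m, forall k,
    cut (v k) b (a k) /\ edist x (a k) < dist (cut (v k) b) x + e / 4.
  suff h k : exists y, cut (v k) b y /\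
      edist x y < dist (cut (v k) b) x + e / 4.
    by have [a aP] := choice h; exists a.
  have [|y yk xy] := @dist_lt _ _ (cut (v k) b) x
    (dist (cut (v k) b) x + e / 4) (cutv_neq0 k b01); last by exists y.
  by rewrite ltrDl.
have [k _|y yP] := @bounded_seq_cluster _ _ a
    (edist 0 x + dist (cut (v 0) b) x + t 0 b + e / 4) 0.
  have [_] := aP k; have := cauchy_cuts Eb (leq0n k) x.
  rewrite ler_norml => /andP[+ _]; have := edist_triangle x 0 (a k).
  by rewrite (edist_sym (a k)); lra.
have yb : lim_cut b y.
  apply: lim_cut_frequently => // d N /yP => /(_ N)[k Nk yk]; exists k => //.
  by apply: le_trans (dist_le _ (aP k).1) _; exact: ltW.
have /(dist_le x) : cut lim_fuzzy b y.
  by rewrite cutE//=; exact: lim_cut_lim_fuzzy.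
have [N NP] := t_cvg0 Eb e4; have [k Nk yk] := yP (e / 4) N e4.
have [_] := aP k; have := NP _ Nk; have := lim_distP x k Eb.
rewrite ler_norml => /andP[_]; have := edist_triangle (a k) x y.
by rewrite (edist_sym (a k) y); lra.
Qed.

(* Levels at which the monotone function [lim_dist q] jumps over [r] from the
   left. *)
Let jump q r : set R :=
  [set a | [/\ E a, r < lim_dist q a &
    forall b, E b -> b < a -> lim_dist q b <= r]].

(** There is at most one such level: of two, the upper one would force [lim_dist q <= r] at the
    lower one. *)
Let negligible_jump q r : mu.-negligible (jump q r).
Proof.
have [[a ja]|j0] := pselect (jump q r !=set0); last first.
  apply: (@negligibleS _ _ _ mu set0); last exact: negligible_set0.
  by move=> a ja; apply: j0; exists a.
apply: (@negligibleS _ _ _ mu [set a]); last first.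
  by exists [set a]; split => //; exact: lebesgue_measure_set1.
move=> a' ja' /=; apply/eqP; rewrite eq_le !leNgt.
apply/andP; split; apply/negP.
  move=> aa'; have [Ea ra _] := ja; have [_ _ /(_ _ Ea aa')] := ja'.
  by rewrite leNgt ra.
move=> a'a; have [Ea' ra' _] := ja'; have [_ _ /(_ _ Ea' a'a)] := ja.
by rewrite leNgt ra'.
Qed.

(** A rational [r] strictly between the right side and a larger left side would make [a] a jump: a
    point of the cut at [a] closer than [r] to [q] lies in the limit cut at every lower [b] in [E],
    so [lim_dist q b <= r]. *)
Let dist_lim_ge q a : E a -> (forall r : rat, ~ jump q (ratr r) a) ->
  lim_dist q a <= dist (cut lim_fuzzy a) q.
Proof.
move=> Ea nj; have a01 := E01 Ea; have /andP[a0 a1] := a01.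
rewrite leNgt; apply/negP => /rat_in_itvoo[r]; rewrite in_itv/= => /andP[dr rl].
apply: (nj r); split => // b Eb ba.
have /dist_lt /(_ dr)[y] : cut lim_fuzzy a !=set0.
  by apply: cut_neq0; [exact: normal_fuzzy_lim|rewrite (ltW a0)].
rewrite cutE//= => ay /ltW qy; apply: le_trans qy.
have b01 := E01 Eb; have /andP[b0 _] := b01.
have yb := lt_lim_fuzzy b0 (lt_le_trans ba ay).
apply/ler_addgt0Pr => e e0; have e2 : 0 < e / 2 by rewrite divr_gt0.
have [N NP] := yb _ e2; have [N' N'P] := t_cvg0 Eb e2.
have := NP _ (leq_maxl N N'); have := N'P _ (leq_maxr N N').
set k := maxn _ _; have := dist_lipschitz q y (cutv_neq0 k b01).
by have := lim_distP q k Eb; rewrite ler_norml => /andP[+ _]; lra.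
Qed.

(** Outside the jumps for the countably many rational pairs [(q, r)], the distance to the cut of
    [lim_fuzzy] equals [lim_dist] at rational points, and [lim_distP] gives the rate. *)
Lemma hausdorff_lim_fuzzy : {ae mu, forall a, I a -> forall k,
  (hausdorff (cut (v k) a) (cut lim_fuzzy a) <= (t k a)%:E)%E}.
Proof.
pose bad n : set R := if unpickle n is Some (q, r) then
  jump (map_mx ratr (q : 'rV[rat]_m)) (ratr (r : rat)) else set0.
have : mu.-negligible (\bigcup_n bad n).
  apply: negligible_bigcup => n; rewrite /bad; case: unpickle => [[q r]|].
    exact: negligible_jump.
  exact: negligible_set0.
move=> badN; apply: negligibleS (negligibleU Eae badN) => a /= nH.
have [gooda|ba] := pselect (~ (\bigcup_n bad n) a); last first.
  by right; exact: contrapT.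
left => Ea; apply: nH => Ia k; have {}Ea := Ea Ia.
have /andP[a0 a1] := E01 Ea.
apply: hausdorff_le.
- exact: cutv_neq0 (E01 Ea).
- by apply: cut_neq0; [exact: normal_fuzzy_lim|rewrite (ltW a0)].
move=> q; set x := map_mx _ _; rewrite lee_fin.
suff -> : dist (cut lim_fuzzy a) x = lim_dist x a by exact: lim_distP.
apply/eqP; rewrite eq_le dist_lim_le//=; apply: dist_lim_ge => // r jr.
by apply: gooda; exists (pickle (q, r)) => //; rewrite /bad pickleK.
Qed.

End FuzzyLimit.

(** * Completeness *)

Section Completeness.
Context {R : realType} {m : nat} {p : R}.
Hypothesis p1 : 1 <= p.
Local Notation mu := (@lebesgue_measure R).
Local Notation I := (`[0%R, 1%R]%classic : set R).
Local Notation dpm := (@dp R m p).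

Let p0 : 0 < p. Proof. exact: lt_le_trans p1. Qed.
Let mI : measurable I. Proof. exact: measurable_itv. Qed.

Lemma summable_dp_cvg (v : nat -> 'rV[R]_m -> R) (c : nat -> \bar R) :
  (forall k, fuzzy_Smp p (v k)) -> (forall k, (dpm (v k) (v k.+1) <= c k)%E) ->
  (\sum_(0 <= k <oo) c k < +oo)%E ->
  exists2 u, fuzzy_Smp p u &
    forall k, (dpm (v k) u <= \sum_(k <= i <oo) c i)%E.
Proof.
move=> Sv vc coo; have nv k := Smp_normal (Sv k).
have c0 k : (0 <= c k)%E by exact: le_trans (dp_ge0 _ _) (vc k).
pose H (i : nat) (a : R) : \bar R := hausdorff (cut (v i) a) (cut (v i.+1) a).
pose T (k : nat) (a : R) : \bar R := (\sum_(k <= i <oo) H i a)%E.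
have mH i : measurable_fun I (H i) by exact: measurable_hausdorff_cut.
have H0 i a : I a -> (0 <= H i a)%E by exact: hausdorff_cut_ge0.
have mT k : measurable_fun I (T k).
  apply: (emeasurable_fun_cvg (fun n a => (\sum_(k <= i < n) H i a)%E)) => //.
    by move=> n; exact: emeasurable_sum.
  by move=> a Ia; apply: is_cvg_nneseries => i _ _; exact: H0.
have T0 k a : I a -> (0 <= T k a)%E.
  by move=> Ia; apply: nneseries_ge0 => i _ _; exact: H0.
have TS k a : I a -> (T k a = H k a + T k.+1 a)%E.
  move=> Ia; rewrite /T (@nneseries_split _ _ k 1); last first.
    by move=> i _; exact: H0.
  by rewrite addn1 big_nat1.
have LT k : (Lp mu I p (T k) <= \sum_(k <= i <oo) c i)%E.
  apply: le_trans (Lp_nneseries mu mI p1 k mH H0) _.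
  by apply: lee_nneseries => [i _ _|i _]; [exact: Lp_ge0|exact: vc].
(* Leaving out level 0 costs only a null set. *)
pose E : set R := [set a : R | 0 < a <= 1 /\ T 0 a \is a fin_num].
have E01 a : E a -> 0 < a <= 1 by case.
have EI a : E a -> I a by move=> /E01/andP[a0 a1]; rewrite /= in_itv/= ltW.
have Eae : {ae mu, forall a, I a -> E a}.
  have T0fin : {ae mu, forall a, I a -> T 0 a \is a fin_num}.
    apply: Lp_fin_num (le_lt_trans (LT 0) coo) => //.
      exact: mT.
    by move=> a; exact: T0.
  have N0 : mu.-negligible [set 0].
    by exists [set 0]; split => //; exact: lebesgue_measure_set1.
  apply: negligibleS (negligibleU T0fin N0) => a /= nE.
  have [->|a0] := eqVneq a 0; [by right|left => Tfin; apply: nE => Ia].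
  split; last exact: Tfin.
  by have /andP[a0' ->] := unit_itv_bounds Ia; rewrite lt_neqAle a0' eq_sym a0.
have Tle a k : E a -> (T k a <= T 0%N a)%E.
  move=> /EI Ia; elim: k => // k; apply: le_trans; rewrite (TS k)//.
  by rewrite leeDr// H0.
have Tfin a k : E a -> T k a \is a fin_num.
  move=> Ea; rewrite ge0_fin_numE; last exact: T0 (EI _ Ea).
  by apply: le_lt_trans (Tle _ _ Ea) _; case: Ea => _; rewrite ltey_eq => ->.
pose t k a := fine (T k a).
have t_cvg0 a : E a -> forall e, 0 < e -> exists N,
     forall k, (N <= k)%N -> t k a <= e.
  move=> Ea e e0; have Ia := EI _ Ea.
  have := @nneseries_tail_cvg _ (H ^~ a) xpredT.
  have -> : (\sum_(0 <= k <oo) H k a < +oo)%E.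
    by have [_] := Ea; rewrite ltey_eq => ->.
  move=> /(_ isT (fun i _ => H0 i a Ia)).
  have e0' : (0 < e%:E :> \bar R)%E by rewrite lte_fin.
  move=> /(_ _ (open_ereal_lt' e0'))[N _ NP]; exists N => k /NP /= Tke.
  by rewrite -lee_fin fineK ?Tfin// ltW.
(* Keeping the tail [T j a] on the left makes the triangle inequality telescope in the induction on
   [j]. *)
have Hchain a k j : E a -> (k <= j)%N ->
    (hausdorff (cut (v k) a) (cut (v j) a) + T j a <= T k a)%E.
  move=> Ea; have Ia := EI _ Ea; have a01 := unit_itv_bounds Ia.
  elim: j => [|j ih].
    by rewrite leqn0 => /eqP ->; rewrite hausdorffxx ?add0e//; exact: cut_neq0.
  rewrite leq_eqVlt => /predU1P[->|kj].
    by rewrite hausdorffxx ?add0e//; exact: cut_neq0.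
  apply: le_trans (ih kj); rewrite (TS j)// addeA leeD2r//.
  by apply: hausdorff_triangle; exact: cut_neq0.
have cauchy_cuts a : E a -> forall k j, (k <= j)%N -> forall x,
    `|dist (cut (v k) a) x - dist (cut (v j) a) x| <= t k a.
  move=> Ea k j kj x; rewrite -lee_fin fineK ?Tfin//.
  have Ia := EI _ Ea; have a01 := unit_itv_bounds Ia.
  apply: le_trans (Hchain _ _ _ Ea kj).
  apply: le_trans (leeDl _ (T0 j a Ia)).
  by apply: hausdorff_ge; exact: cut_neq0.
have sv k : fuzzy_star_shaped (v k) by have [] := Sv k.
have bv k a (a01 : 0 < a <= 1) := Smp_cut_bounded p1 (Sv k) a01.
pose u := lim_fuzzy v.
have nu : normal_fuzzy u :=
  normal_fuzzy_lim nv sv bv E01 Eae t_cvg0 cauchy_cuts.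
have dvu k : (dpm (v k) u <= \sum_(k <= i <oo) c i)%E.
  apply: le_trans (LT k); rewrite dpE; apply: le_Lp => //.
  - exact: measurable_hausdorff_cut.
  - exact: mT.
  - by move=> a; exact: hausdorff_cut_ge0.
  - by move=> a; exact: T0.
  have Hlim := hausdorff_lim_fuzzy nv sv bv E01 Eae t_cvg0 cauchy_cuts.
  apply: negligibleS (negligibleU Eae Hlim) => a /= nH.
  have [IE|] := pselect (I a -> E a); last by left.
  right => Ha; apply: nH => Ia; apply: le_trans (Ha Ia k) _.
  by rewrite fineK// Tfin//; exact: IE.
exists u => //; apply: Smp_of_dp_origin => //.
- exact: fuzzy_set_lim.
- exact: upper_semicontinuous_lim nv E01 Eae.
- exact: fuzzy_star_shaped_lim nv sv bv E01 Eae t_cvg0 cauchy_cuts.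
(* The distance from [u] to the origin is finite through [v 0]. *)
apply: (@le_lt_trans _ _ (dpm u (v 0%N) + dpm (v 0%N) fuzzy_origin)%E).
  by apply: dp_triangle => //; exact: normal_fuzzy_origin.
rewrite dp_sym lte_add_pinfty//; last exact: Smp_dp_origin.
exact: le_lt_trans (dvu 0) coo.
Qed.

Lemma complete_on_Smp : complete_on (@fuzzy_Smp R m p) dpm.
Proof.
move=> s Ss cauchy.
pose c (k : nat) : \bar R := (1 / (2 ^ (k + 1))%:R)%:E.
have c_gt0 k : 0 < 1 / (2 ^ (k + 1))%:R :> R.
  by rewrite divr_gt0// ltr0n expn_gt0.
have [N NP] := choice (fun k => cauchy _ (c_gt0 k)).
(* The running maximum makes the indices nondecreasing, so [n k] and [n k.+1] are both at least
   [N k]. *)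
pose n k := \max_(i < k.+1) N i.
have Nn k : (N k <= n k)%N.
  exact: (@leq_bigmax _ (fun i : 'I_k.+1 => N i) ord_max).
have nS k : (n k <= n k.+1)%N by rewrite /n [leqRHS]big_ord_recr/= leq_maxl.
pose v k := s (n k).
have vc k : (dpm (v k) (v k.+1) <= c k)%E.
  by apply/ltW/NP; [exact: Nn|exact: leq_trans (Nn k) (nS k)].
have coo : (\sum_(0 <= k <oo) c k < +oo)%E.
  by rewrite (cvg_lim _ (@cvg_geometric_eseries_half R 1 0))// ltry.
have [u Su vu] := summable_dp_cvg (fun k => Ss (n k)) vc coo.
exists u => //.
have d_lt e : 0 < e -> exists K, forall i, (K <= i)%N -> (dpm (s i) u < e%:E)%E.
  move=> e0; have e2 : 0 < e / 2 by rewrite divr_gt0.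
  have c0 k : (0 <= c k)%E by rewrite lee_fin ltW.
  have := @nneseries_tail_cvg _ c xpredT coo (fun i _ => c0 i).
  have e2' : (0 < (e / 2)%:E :> \bar R)%E by rewrite lte_fin.
  (* A single tail below [e / 2] controls both [dpm (v k) u] and its own first term [c k], which
     bounds [dpm (s i) (v k)] for late [i]. *)
  move=> /(_ _ (open_ereal_lt' e2'))[k _ /(_ k (leqnn k))/= tke].
  exists (n k) => i nki.
  have duv : (dpm (s i) u <= dpm (s i) (v k) + dpm (v k) u)%E.
    apply: dp_triangle => //; try exact: Smp_normal (Ss _).
    exact: Smp_normal Su.
  apply: le_lt_trans duv _.
  rewrite [e]splitr EFinD; apply: lteD; last exact: le_lt_trans (vu k) tke.
  apply: lt_trans tke; apply: (@lt_le_trans _ _ (c k)).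
    by apply: NP => //; exact: leq_trans (Nn k) nki.
  rewrite (@nneseries_split _ _ k 1)// addn1 big_nat1 leeDl//.
  exact: nneseries_ge0.
have dfin i : dpm (s i) u \is a fin_num.
  by rewrite ge0_fin_numE ?dp_ge0// dp_fin.
apply/fine_cvgP; split; first exact: nearW.
apply/cvgrPdist_lt => e /d_lt[K KP]; exists K => // i /KP /= de.
by rewrite sub0r normrN ger0_norm ?fine_ge0 ?dp_ge0// -lte_fin fineK.
Qed.

End Completeness.

Theorem theorem6p8 (R : realType) (m : nat) (p : R)
    (hm : (1 <= m)%N) (hp : 1 <= p) :
  is_completion_of (@fuzzy_Smp R m p) (@fuzzy_Sm R m) (@dp R m p).
Proof.
split.
- exact: metric_on_Smp.
- exact: Sm_sub_Smp.
- exact: complete_on_Smp.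
- exact: dense_Sm_Smp.
Qed.
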